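(* Let $\alpha,\beta,\gamma$ be positive irrational real numbers with $\alpha+\beta+\gamma=1$, and suppose $\beta/\gamma\notin\mathbb{Q}$. Define $$\widetilde{b}(n)=\left\lfloor\left\lfloor\frac{1-\alpha}{\beta}n\right\rfloor\frac{1}{1-\alpha}\right\rfloor,\qquad \widetilde{c}(n)=\left\lfloor\left\lfloor\frac{1-\alpha}{\gamma}n\right\rfloor\frac{1}{1-\alpha}\right\rfloor\quad(n\in\mathbb{N}).$$ Then the sets $B_\alpha$, $\widetilde{B_\beta}=\{\widetilde{b}(n):n\in\mathbb{N}\}$ and $\widetilde{B_\gamma}=\{\widetilde{c}(n):n\in\mathbb{N}\}$ form a partition of $\mathbb{N}$, and with $b(n)=\lfloor n/\beta\rfloor$, $c(n)=\lfloor n/\gamma\rfloor$, $$\|\widetilde{b}-b\|\le \left\lfloor \frac{2-\alpha}{1-\alpha}\right\rfloor,\qquad \|\widetilde{c}-c\|\le \left\lfloor \frac{2-\alpha}{1-\alpha}\right\rfloor.$$ In particular, if $\alpha<1/2$, then $\|\widetilde{b}-b\|\le 2$ and $\|\widetilde{c}-c\|\le 2$.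
   Context: $\mathbb{N}=\{1,2,3,\dots\}$. A partition of $\mathbb{N}$ is a collection of subsets such that every positive integer lies in exactly one of them. For $0<\alpha<1$, $B_\alpha=\{\lfloor n/\alpha\rfloor:n\in\mathbb{N}\}$ is the Beatty sequence of density $\alpha$. For sequences $a,b$ indexed by $\mathbb{N}$, $\|a-b\|=\sup\{|a(n)-b(n)|:n\in\mathbb{N}\}$. *)

(* Defs.v *)
From HB Require Import structures.
From mathcomp Require Import all_boot all_order all_algebra.
From mathcomp Require Import boolp classical_sets reals ereal.

Set Implicit Arguments.
Unset Strict Implicit.
Unset Printing Implicit Defensive.
Import Order.TTheory GRing.Theory Num.Theory.
Local Open Scope classical_set_scope.
Local Open Scope ring_scope.

(* MathComp's [nat] contains 0, whereas here the natural numbers are 1, 2, ...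
   Sequences indexed by 1, 2, ... are maps [nat -> int] whose value at 0 is
   never used: every image and supremum below ranges over [pos_index]. *)
Definition pos_index : set nat := [set n | (0 < n)%N].
Definition pos_int : set int := [set m | 0 < m].

Definition terms (a : nat -> int) : set int := a @` pos_index.

(* A partition in the sense "subsets, exactly one of which contains any given
   positive integer"; unlike [classical_sets.partition], the blocks are not
   required to be nonempty. *)
Definition partition_pos (I : Type) (F : I -> set int) : Prop :=
  (forall i, F i `<=` pos_int) /\ (forall m, pos_int m -> exists! i, F i m).

(* The supremum is extended-real valued, so that it is meaningful (and equal to
   +oo) also for sequences at unbounded distance. *)
Definition seq_dist (R : realType) (a b : nat -> int) : \bar R :=
  ereal_sup [set `|(a n - b n)%:~R : R|%:E | n in pos_index].

Definition beatty (R : realType) (alpha : R) (n : nat) : int :=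
  Num.floor (n%:R / alpha).

(* For alpha + beta + gamma = 1, [delta] is meant to be beta (giving the
   sequence b~) or gamma (giving c~). *)
Definition beatty_tilde (R : realType) (alpha delta : R) (n : nat) : int :=
  Num.floor
    ((Num.floor ((1 - alpha) / delta * n%:R))%:~R * (1 / (1 - alpha))).

(* Main.v *)
(** Rayleigh's theorem, proved here by comparing the integer parts of
    [m x] and [(m + 1) x], splits the positive integers into [B_alpha] and
    [B_(1 - alpha)], and also (since [beta / (1 - alpha)] and
    [gamma / (1 - alpha)] add up to 1) into the sets of indices
    [floor (n (1 - alpha) / beta)] and [floor (n (1 - alpha) / gamma)].
    Evaluating the injective sequence [floor (k / (1 - alpha))] at these two
    sets of indices splits [B_(1 - alpha)] into the ranges of [b~] and [c~].
    The distance bound holds since dropping the inner floor changes the argument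
    of the outer one by less than [1 / (1 - alpha)]. *)
Require Import Defs.
From mathcomp Require Import all_boot all_order all_algebra.
From mathcomp Require Import boolp classical_sets reals ereal.
From mathcomp Require Import lra ring zify.
Import Order.TTheory GRing.Theory Num.Theory.
Local Open Scope classical_set_scope.
Local Open Scope ring_scope.

Lemma irrational_onem (R : realType) (x : R) :
  irrational x -> irrational (1 - x).
Proof.
move=> xI [q _ qE]; apply: xI; exists (1 - q) => //.
by rewrite rmorphB rmorph1 /= qE; ring.
Qed.

Lemma irrational_mulz_neq (R : realType) (x : R) (m k : int) :
  irrational x -> m != 0 -> m%:~R * x != k%:~R.
Proof.
move=> xI m0; apply/eqP => mxk; apply: xI; exists (k%:~R / m%:~R) => //.
have m0' : m%:~R != 0 :> R by rewrite intr_eq0.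
by rewrite fmorph_div /= !ratr_int -mxk mulrC mulKf.
Qed.

(** If [x / (x + y)] were a rational [q], then [x / y = q / (1 - q)] would be rational too. *)
Lemma irrational_share (R : realType) (x y : R) :
  0 < x -> 0 < y -> irrational (x / y) -> irrational (x / (x + y)).
Proof.
move=> x0 y0 xyI [q _ qE]; apply: xyI; exists (q / (1 - q)) => //.
rewrite fmorph_div rmorphB rmorph1 /= qE; field.
by apply/andP; split; apply: lt0r_neq0; lra.
Qed.

(** Each step of [n] raises [n / x] by [1 / x >= 1], so the integer parts strictly increase. *)
Lemma beatty_inj (R : realType) (x : R) :
  0 < x -> x <= 1 -> injective (beatty x).
Proof.
move=> x0 x1.
suff mono n n' : (n < n')%N -> beatty x n < beatty x n'.
  move=> n n' e; case: (ltngtP n n') => // /mono; rewrite e => h; lia.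
move=> nn'; rewrite /beatty -lezD1 floor_ge_int intrD.
have hn : n%:R + 1 <= n'%:R :> R by rewrite natr1 ler_nat.
have := floor_le (n%:R / x); set f := Num.floor _ => hf.
rewrite ler_pdivlMr //; rewrite ler_pdivlMr // in hf; nra.
Qed.

Lemma beatty_gt0 (R : realType) (x : R) (n : nat) :
  0 < x -> x <= 1 -> (0 < n)%N -> 0 < beatty x n.
Proof.
move=> x0 x1 n0; rewrite floor_gt0 ler_pdivlMr // mul1r.
by apply: le_trans x1 _; rewrite ler1n.
Qed.

(* [m] is a term iff the interval [m x <= n < (m + 1) x] contains an
   integer; by irrationality the left end can be made strict. *)
Lemma terms_beattyP (R : realType) (x : R) (m : int) :
  0 < x -> irrational x -> 0 < m ->
  terms (beatty x) m <->
  Num.floor (m%:~R * x) < Num.floor ((m + 1)%:~R * x).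
Proof.
move=> x0 xI m0.
have m1x (k : int) : k%:~R != (m + 1)%:~R * x.
  by rewrite eq_sym irrational_mulz_neq //; lia.
have mx (k : int) : k%:~R != m%:~R * x.
  by rewrite eq_sym irrational_mulz_neq //; lia.
split.
  case=> n n0 /eqP; rewrite /beatty floor_eq ler_pdivlMr // ltr_pdivrMr //.
  case/andP => lo hi; apply: (@lt_le_trans _ _ n%:Z).
    by rewrite floor_lt_int lt_neqAle lo eq_sym mx.
  by rewrite floor_ge_int ltW.
(* The witness is the last integer below [(m + 1) x]. It exceeds [floor (m x)], hence [m x] itself,
   and irrationality keeps it off the right end. *)
set n := Num.floor ((m + 1)%:~R * x) => fn.
have n0 : 0 < n.
  apply: le_lt_trans fn; rewrite floor_ge0 mulr_ge0 ?ltW //.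
  by rewrite ltr0z.
exists `|n|%N; first by rewrite /pos_index /= absz_gt0 gt_eqF.
apply/eqP; rewrite /beatty natr_absz gtr0_norm // floor_eq.
rewrite ler_pdivlMr // ltr_pdivrMr //; apply/andP; split.
  by apply: ltW; rewrite -floor_lt_int.
by rewrite lt_neqAle m1x floor_le.
Qed.

(** Since [m x] is not an integer, [floor (- m x) = - floor (m x) - 1]. *)
Lemma floor_onem (R : realType) (x : R) (m : int) :
  irrational x -> m != 0 ->
  Num.floor (m%:~R * (1 - x)) = m - 1 - Num.floor (m%:~R * x).
Proof.
move=> xI m0; apply: floor_def.
have /andP[] := floor_itv (m%:~R * x); rewrite le_eqVlt eq_sym.
rewrite (negPf (irrational_mulz_neq _ _ _ _ xI m0)) /=.
set k := Num.floor _; rewrite !intrD !intrN /= => lo hi.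
by apply/andP; split; lra.
Qed.

Lemma rayleigh (R : realType) (x : R) (m : int) :
  0 < x -> x < 1 -> irrational x -> 0 < m ->
  terms (beatty x) m <-> ~ terms (beatty (1 - x)) m.
Proof.
move=> x0 x1 xI m0; rewrite terms_beattyP // terms_beattyP //; last 2 first.
- by rewrite subr_gt0.
- exact: irrational_onem.
(* From [m] to [m + 1], the increments of [floor (m x)] and [floor (m (1 - x))] now add up to 1. As
   [0 < x < 1], the first is 0 or 1, so exactly one of the two is positive. *)
rewrite !floor_onem //; [|lia|lia].
have /andP[lo hi] := floor_itv (m%:~R * x).
have /andP[lo' hi'] := floor_itv ((m + 1)%:~R * x).
move: lo hi lo' hi'; set f := Num.floor _; set g := Num.floor _.
rewrite !intrD => lo hi lo' hi'.
have : f < g + 1 by rewrite -(ltr_int R) intrD; lra.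
have : g < f + 2 by rewrite -(ltr_int R) intrD; lra.
lia.
Qed.

Lemma beatty_tildeE (R : realType) (alpha delta : R) (n : nat) :
  alpha < 1 -> 0 < delta -> delta <= 1 - alpha -> (0 < n)%N ->
  beatty_tilde alpha delta n =
  beatty (1 - alpha) `|beatty (delta / (1 - alpha)) n|%N.
Proof.
move=> a1 d0 da n0.
have a0 : 0 < 1 - alpha by rewrite subr_gt0.
(* The inner term is positive, so turning it into a natural index by the absolute value preserves
   it. *)
rewrite /beatty_tilde {1}/beatty natr_absz gtr0_norm; last first.
  by apply: beatty_gt0; rewrite ?divr_gt0 // ler_pdivrMr // mul1r.
by rewrite /beatty invf_div mul1r [_ * n%:R]mulrC.
Qed.

Lemma terms_beatty_tildeP (R : realType) (alpha delta : R) (m : int) :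
  alpha < 1 -> 0 < delta -> delta <= 1 - alpha ->
  terms (beatty_tilde alpha delta) m <->
  exists k : nat, [/\ (0 < k)%N, terms (beatty (delta / (1 - alpha))) k%:Z
                    & beatty (1 - alpha) k = m].
Proof.
move=> a1 d0 da; have a0 : 0 < 1 - alpha by rewrite subr_gt0.
split=> [[n n0 <-]|[k [k0 [n n0 nk] <-]]]; last first.
  by exists n => //; rewrite beatty_tildeE // nk.
have k0 : 0 < beatty (delta / (1 - alpha)) n.
  by apply: beatty_gt0; rewrite ?divr_gt0 // ler_pdivrMr // mul1r.
exists `|beatty (delta / (1 - alpha)) n|%N; rewrite beatty_tildeE //; split=> //.
- by rewrite absz_gt0 gt_eqF.
- by exists n => //; rewrite gez0_abs // ltW.
Qed.

Lemma partition_pos3 (A B C : set int) :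
  A `<=` pos_int -> B `<=` pos_int -> C `<=` pos_int ->
  (forall m, pos_int m -> [\/ A m, B m | C m]) ->
  (forall m, A m -> ~ B m) -> (forall m, A m -> ~ C m) ->
  (forall m, B m -> ~ C m) ->
  partition_pos (tnth [tuple A; B; C]).
Proof.
move=> A0 B0 C0 cover AB AC BC; split; first by case=> [[|[|[|]]]].
move=> m m0; have uniq (i j : 'I_3) : tnth [tuple A; B; C] i m ->
    tnth [tuple A; B; C] j m -> i = j.
  case: i j => [[|[|[|//]]] ?] [[|[|[|//]]] ?];
    rewrite !(tnth_nth set0) /= => P Q; try exact: val_inj.
  - by case: (AB m).
  - by case: (AC m).
  - by case: (AB m).
  - by case: (BC m).
  - by case: (AC m).
  - by case: (BC m).
have [i im] : exists i, tnth [tuple A; B; C] i m.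
  by case: (cover m m0) => P; [exists 0|exists 1|exists 2%:R];
    rewrite (tnth_nth set0).
by exists i; split=> // j; apply: uniq.
Qed.

Lemma seq_dist_beatty_tilde (R : realType) (alpha delta : R) :
  alpha < 1 -> 0 < delta ->
  (seq_dist R (beatty_tilde alpha delta) (beatty delta) <=
   ((Num.floor ((2 - alpha) / (1 - alpha)))%:~R)%:E)%E.
Proof.
move=> a1 d0; have a0 : 0 < 1 - alpha by rewrite subr_gt0.
apply: ge_ereal_sup => _ [n _ <-].
(* The difference is an integer, so it is enough to bound it by the real number under the floor. *)
rewrite lee_fin -intr_norm ler_int floor_ge_int.
rewrite /beatty_tilde /beatty.
have /andP[] := floor_itv ((1 - alpha) / delta * n%:R).
set k := Num.floor (_ * n%:R); rewrite intrD => klo khi.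
have nE : n%:R / delta = (1 - alpha) / delta * n%:R * (1 / (1 - alpha)).
  by field; rewrite !gt_eqF.
have c0 : 0 < 1 / (1 - alpha) by rewrite divr_gt0.
have uv : k%:~R * (1 / (1 - alpha)) <= n%:R / delta.
  by rewrite nE ler_pM2r.
have uv' : n%:R / delta < (k%:~R + 1) * (1 / (1 - alpha)).
  by rewrite nE ltr_pM2r.
(* The summand [1 / (1 - alpha)] pays for the inner floor, and 1 for the two outer floors. *)
have -> : (2 - alpha) / (1 - alpha) = 1 + 1 / (1 - alpha).
  by field; rewrite gt_eqF.
rewrite ler0_norm; last by rewrite subr_le0 le_floor.
have /andP[_] := floor_itv (k%:~R * (1 / (1 - alpha))).
have /andP[+ _] := floor_itv (n%:R / delta).
by rewrite opprB intrB intrD; lra.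
Qed.

Theorem theorem3 (R : realType) (alpha beta gamma : R)
    (alpha_gt0 : 0 < alpha) (beta_gt0 : 0 < beta) (gamma_gt0 : 0 < gamma)
    (alpha_irr : irrational alpha) (beta_irr : irrational beta)
    (gamma_irr : irrational gamma)
    (sum1 : alpha + beta + gamma = 1)
    (ratio_irr : irrational (beta / gamma)) :
  let b := beatty beta in
  let c := beatty gamma in
  let bt := beatty_tilde alpha beta in
  let ct := beatty_tilde alpha gamma in
  let bound : \bar R :=
    ((Num.floor ((2 - alpha) / (1 - alpha)))%:~R)%:E in
  [/\ partition_pos (tnth [tuple terms (beatty alpha); terms bt; terms ct]),
      (seq_dist R bt b <= bound)%E,
      (seq_dist R ct c <= bound)%E
    & alpha < 1 / 2 ->
      (seq_dist R bt b <= 2%:E)%E /\ (seq_dist R ct c <= 2%:E)%E].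
Proof.
move=> b c bt ct bound.
have a1 : alpha < 1 by lra.
have a0 : 0 < 1 - alpha by lra.
have ba : beta <= 1 - alpha by lra.
have ga : gamma <= 1 - alpha by lra.
have db : (seq_dist R bt b <= bound)%E by exact: seq_dist_beatty_tilde.
have dc : (seq_dist R ct c <= bound)%E by exact: seq_dist_beatty_tilde.
split=> //; last first.
  move=> a2; have bound2 : (bound <= 2%:E)%E.
    (* For [alpha < 1 / 2] the quotient is below 3, so its floor is at most 2. *)
    rewrite lee_fin (ler_int R _ 2) -ltzD1 floor_lt_int.
    by rewrite ltr_pdivrMr // intrD; lra.
  by split; apply: le_trans bound2.
set x := beta / (1 - alpha).
have x0 : 0 < x by rewrite divr_gt0.
have x1 : x < 1 by rewrite ltr_pdivrMr //; lra.
(* With [1 - alpha = beta + gamma], the irrationality of [beta / gamma] makes Rayleigh's theorem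
   available for the indices as well. *)
have xI : irrational x.
  have -> : x = beta / (beta + gamma) by congr (_ / _); lra.
  exact: irrational_share.
have yE : gamma / (1 - alpha) = 1 - x.
  rewrite /x; have -> : gamma = 1 - alpha - beta by lra.
  by field; rewrite gt_eqF.
have btP m := terms_beatty_tildeP R alpha beta m a1 beta_gt0 ba.
have ctP m := terms_beatty_tildeP R alpha gamma m a1 gamma_gt0 ga.
have sub_bt m : terms bt m -> terms (beatty (1 - alpha)) m.
  by move=> /btP[k [k0 _ <-]]; exists k.
have sub_ct m : terms ct m -> terms (beatty (1 - alpha)) m.
  by move=> /ctP[k [k0 _ <-]]; exists k.
have pos z : 0 < z -> z <= 1 -> terms (@beatty R z) `<=` pos_int.
  by move=> z0 z1 _ [n n0 <-]; exact: beatty_gt0.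
have posA : terms (beatty alpha) `<=` pos_int by apply: pos => //; lra.
have posA' : terms (beatty (1 - alpha)) `<=` pos_int by apply: pos => //; lra.
apply: partition_pos3 => //.
- by move=> m /sub_bt/posA'.
- by move=> m /sub_ct/posA'.
- move=> m m0; have [|] := pselect (terms (beatty (1 - alpha)) m); last first.
    by move=> /(rayleigh _ _ _ alpha_gt0 a1 alpha_irr m0); constructor 1.
  case=> k k0 km; have [kc|] := pselect (terms (beatty (1 - x)) k%:Z).
    by constructor 3; apply/ctP; exists k; rewrite yE.
  move=> /(rayleigh _ _ k%:Z x0 x1 xI k0) kb.
  by constructor 2; apply/btP; exists k.
- by move=> m Am /sub_bt; apply/(rayleigh _ _ _ alpha_gt0 a1 alpha_irr (posA _ Am)).
- by move=> m Am /sub_ct; apply/(rayleigh _ _ _ alpha_gt0 a1 alpha_irr (posA _ Am)).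
(* A common term would, by injectivity, come from a single index [k] lying in both complementary
   index sets. *)
- move=> m /btP[k [k0 kb <-]] /ctP[k' [k'0 kc]].
  have a1' : 1 - alpha <= 1 by lra.
  move/(beatty_inj _ _ a0 a1') => kk; move: kc; rewrite kk yE.
  exact/(rayleigh _ _ k%:Z x0 x1 xI k0).
Qed.
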